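(* For every integer $n\ge 1$, \[\overline{p}(3n)\equiv (-1)^n\, r_5(n) \pmod 9.\]
   Context: An overpartition of a nonnegative integer $n$ is a partition of $n$ in which the first occurrence of each distinct part may (or may not) be overlined; $\overline{p}(n)$ denotes the number of overpartitions of $n$ (with $\overline{p}(0)=1$). Equivalently, $\sum_{n\ge0}\overline{p}(n)q^n=\prod_{k\ge1}\frac{1+q^k}{1-q^k}=1/\varphi(-q)$, where $\varphi(q)=\sum_{n=-\infty}^{\infty}q^{n^2}$. For an integer $k\ge1$, $r_k(n)$ denotes the number of $(x_1,\dots,x_k)\in\mathbb{Z}^k$ with $x_1^2+\cdots+x_k^2=n$. *)

(* Defs.v *)
From mathcomp Require Import all_boot all_order all_algebra.
Set Implicit Arguments. Unset Strict Implicit. Unset Printing Implicit Defensive.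
Import GRing.Theory Num.Theory.

(* Overpartitions of n in multiplicity form.  A partition of n is determined by
   the multiplicity m k of each part size k (1 <= k <= n, and m k <= n), with
   \sum_k k * m k = n.  An overpartition additionally marks (overlines) the first
   occurrence of some of the distinct parts: a flag o k that may be true only if
   part k actually occurs (m k > 0).  Index i : 'I_n stands for part size i+1. *)
Definition is_overpartition (n : nat)
    (m : {ffun 'I_n -> 'I_n.+1}) (o : {ffun 'I_n -> bool}) : bool :=
  ((\sum_(i < n) i.+1 * m i)%N == n) && [forall i, o i ==> (0 < m i)%N].

Definition overpartition_count (n : nat) : nat :=
  #|[set mo : {ffun 'I_n -> 'I_n.+1} * {ffun 'I_n -> bool}
     | is_overpartition mo.1 mo.2]|.

(* r_k(n): number of (x_1,...,x_k) in Z^k with x_1^2+...+x_k^2 = n.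
   Every such x has |x_i| <= n, so we enumerate x_i = j - n with j in [0, 2n]. *)
Definition r_sq (k n : nat) : nat :=
  #|[set x : {ffun 'I_k -> 'I_(2 * n + 1)} |
      (\sum_(i < k) ((x i)%:Z - n%:Z) ^+ 2 == n%:Z)%R]|.

(* Main.v *)
Require Import Defs.
From mathcomp Require Import all_boot all_order all_algebra all_field.
From mathcomp Require Import ring zify.
Set Implicit Arguments.
Unset Strict Implicit.
Unset Printing Implicit Defensive.
Import GRing.Theory Num.Theory.
Local Open Scope ring_scope.

(** Put [t(q) = sum_j (-1)^j q^(j^2)], the sum being over all integers. By Gauss,
    [t(q) = prod_k (1 - q^k)/(1 + q^k)], so the generating series of
    overpartitions is [1/t(q)]. Let [w] be a primitive cube root of unity. The
    product formula gives [t(q) t(wq) t(w^2 q) = t(q^3)^4 / t(q^9)], and since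
    squares are 0 modulo 9 or 1 modulo 3, [t(q) = t(q^9) + b(q)] with
    [b(wq) = w b(q)]. Averaging [1/t] over [q], [wq], [w^2 q] then yields
    [sum_n p(3n) q^n = t(q^3)^3 / t(q)^4], and [t(q^3)^3 = t(q)^9] modulo 9, which
    leaves [t(q)^5]. All series are handled as polynomials modulo a power of [X]. *)

(** * Equality of polynomials modulo a power of [X] *)

Section TruncatedEquality.
Variable R : comNzRingType.
Implicit Types p q u : {poly R}.

Definition eqXn (N : nat) p q := forall i, (i < N)%N -> p`_i = q`_i.

Lemma eqXn_refl N p : eqXn N p p. Proof. by []. Qed.

Lemma eqXn_sym N p q : eqXn N p q -> eqXn N q p.
Proof. by move=> h i /h. Qed.

Lemma eqXn_trans N q p r : eqXn N p q -> eqXn N q r -> eqXn N p r.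
Proof. by move=> h k i iN; rewrite h // k. Qed.

Lemma eqXn_leq M N p q : (M <= N)%N -> eqXn N p q -> eqXn M p q.
Proof. by move=> MN h i iM; apply: h; apply: leq_trans MN. Qed.

Lemma eqXnD N p1 p2 q1 q2 :
  eqXn N p1 q1 -> eqXn N p2 q2 -> eqXn N (p1 + p2) (q1 + q2).
Proof. by move=> h k i iN; rewrite !coefD h // k. Qed.

Lemma eqXnM N p1 p2 q1 q2 :
  eqXn N p1 q1 -> eqXn N p2 q2 -> eqXn N (p1 * p2) (q1 * q2).
Proof.
move=> h k i iN; rewrite !coefM; apply: eq_bigr => j _.
by rewrite h ?k //; have := ltn_ord j; lia.
Qed.

Lemma eqXnX N p q k : eqXn N p q -> eqXn N (p ^+ k) (q ^+ k).
Proof.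
by move=> h; elim: k => [|k IH]; rewrite ?expr0 // !exprS; apply: eqXnM.
Qed.

Lemma eqXn_prod N (I : Type) (r : seq I) (F G : I -> {poly R}) :
  (forall i, eqXn N (F i) (G i)) ->
  eqXn N (\prod_(i <- r) F i) (\prod_(i <- r) G i).
Proof.
move=> h; elim: r => [|i r IH]; first by rewrite !big_nil.
by rewrite !big_cons; apply: eqXnM.
Qed.

Lemma eqXn_addXn N k p q : (N <= k)%N -> eqXn N (p + q * 'X^k) p.
Proof. by move=> Nk i iN; rewrite coefD coefMXn (leq_trans iN Nk) addr0. Qed.

(** Multiplication by [u] acts on coefficients as a triangular system with unit diagonal, so strong
    induction on the index cancels it. This replaces division of power series. *)
Lemma eqXn_mul2l N u p q : u`_0 = 1 -> eqXn N (u * p) (u * q) -> eqXn N p q.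
Proof.
move=> u0 h; elim/ltn_ind => i IH iN; have := h i iN.
rewrite !coefM !big_ord_recl /= u0 !mul1r subn0.
suff -> : \sum_(j < i) u`_(bump 0 j) * p`_(i - bump 0 j) =
          \sum_(j < i) u`_(bump 0 j) * q`_(i - bump 0 j) by apply: addIr.
by apply: eq_bigr => j _; rewrite IH // /bump; have := ltn_ord j; lia.
Qed.

Lemma eqXn_comp_polyXn d N p q : (0 < d)%N ->
  eqXn N p q -> eqXn (d * N) (p \Po 'X^d) (q \Po 'X^d).
Proof.
move=> d0 h i iN; rewrite !coef_comp_poly_Xn //; case: ifP => // _.
by apply: h; rewrite ltn_divLR // mulnC.
Qed.

Lemma eqXn_comp_polyXnI d N p q : (0 < d)%N ->
  eqXn (d * N).+1 (p \Po 'X^d) (q \Po 'X^d) -> eqXn N.+1 p q.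
Proof.
move=> d0 h i iN; have := h (d * i)%N; rewrite !coef_comp_poly_Xn // dvdn_mulr //.
by rewrite mulKn //; apply; rewrite ltnS leq_pmul2l.
Qed.

Lemma coef_comp_polyZX (w : R) p i : (p \Po (w *: 'X))`_i = w ^+ i * p`_i.
Proof.
rewrite comp_polyE coef_sum -[in RHS](coefK p) coef_poly.
under eq_bigr => j _ do rewrite exprZn !coefZ coefXn.
case: ltnP => [ip|pi].
  rewrite (bigD1 (Ordinal ip)) //= eqxx big1 ?mulr1 ?addr0 1?mulrC //.
  move=> j /eqP ji; case: eqP => [E|]; last by rewrite !mulr0.
  by case: ji; apply/val_inj.
rewrite mulr0 big1 // => j _; case: eqP => [E|]; last by rewrite !mulr0.
by have := ltn_ord j; lia.
Qed.

Lemma eqXn_comp_polyZX N (w : R) p q :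
  eqXn N p q -> eqXn N (p \Po (w *: 'X)) (q \Po (w *: 'X)).
Proof. by move=> h i iN; rewrite !coef_comp_polyZX h. Qed.

End TruncatedEquality.

(** * Gauss's identity and the generating series of overpartitions *)

Section Gauss.
Variable R : comNzRingType.

Definition mprod (n : nat) : {poly R} := \prod_(k < n) (1 - 'X^(k.+1)).
Definition pprod (n : nat) : {poly R} := \prod_(k < n) (1 + 'X^(k.+1)).
(** The part of [t(q)] with [|j| <= n], where [j] and [-j] are merged into one doubled term. *)
Definition theta (n : nat) : {poly R} :=
  1 + (\sum_(s < n) (-1) ^+ s.+1 * 'X^(s.+1 ^ 2)) *+ 2.
(** For [s <= n] this is the quotient of [mprod n] by [mprod s], written without division. *)
Definition mtail (s n : nat) : {poly R} := \prod_(s <= k < n) (1 - 'X^(k.+1)).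

Lemma mtailS s n : (s <= n)%N -> mtail s n.+1 = mtail s n * (1 - 'X^(n.+1)).
Proof. by move=> sn; rewrite /mtail big_nat_recr. Qed.

Lemma mtail_ltn s n : (s < n)%N -> mtail s n = (1 - 'X^(s.+1)) * mtail s.+1 n.
Proof. by move=> sn; rewrite /mtail big_ltn. Qed.

Lemma mtail0 n : mtail 0 n = mprod n.
Proof. by rewrite /mtail /mprod big_mkord. Qed.

Lemma mtailnn n : mtail n n = 1.
Proof. by rewrite /mtail big_geq. Qed.

Lemma mprodS n : mprod n.+1 = mprod n * (1 - 'X^(n.+1)).
Proof. by rewrite /mprod big_ord_recr. Qed.

Lemma pprodS n : pprod n.+1 = pprod n * (1 + 'X^(n.+1)).
Proof. by rewrite /pprod big_ord_recr. Qed.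

(* Shanks' finite form of Gauss's identity; the step telescopes. *)
Lemma pprod_theta n :
  pprod n * theta n = mprod n +
    (\sum_(s < n) (-1) ^+ s.+1 * pprod s * mtail s.+1 n * 'X^(s.+1 * n.+1)) *+ 2.
Proof.
elim: n => [|n IH]; first by rewrite /pprod /mprod /theta !big_ord0 mul0rn !addr0 mulr1.
(* Telescoping potential: apart from the common factor [1 + 'X^(n.+1)], passing from [n] to [n.+1]
   changes the summand at [s] by a difference of consecutive signed values of [F]. *)
pose F s := pprod s * mtail s n * 'X^(s.+1 * n.+1).
have -> : pprod n.+1 * theta n.+1 = pprod n * theta n * (1 + 'X^(n.+1)) +
    ((-1) ^+ n.+1 * pprod n.+1 * 'X^(n.+1 ^ 2)) *+ 2.
  by rewrite pprodS /theta big_ord_recr /=; ring.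
rewrite IH big_ord_recr /= mtailnn mulr1.
have -> : \sum_(s < n) (-1) ^+ s.+1 * pprod s * mtail s.+1 n.+1 * 'X^(s.+1 * n.+2) =
    (1 + 'X^(n.+1)) * (\sum_(s < n) (-1) ^+ s.+1 * pprod s * mtail s.+1 n * 'X^(s.+1 * n.+1))
     + (F 0%N - (-1) ^+ n * F n).
  have -> : F 0%N - (-1) ^+ n * F n =
      \sum_(s < n) ((-1) ^+ s * F s - (-1) ^+ s.+1 * F s.+1).
    rewrite -(big_mkord xpredT (fun s => (-1) ^+ s * F s - (-1) ^+ s.+1 * F s.+1)).
    rewrite (telescope_sumr_eq (fun s => - ((-1) ^+ s * F s))) ?expr0 //; last first.
      by move=> s _; rewrite opprK addrC.
    by rewrite opprK addrC mul1r.
  rewrite mulr_sumr -big_split; apply: eq_bigr => s _ /=.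
  rewrite /F mtailS; last exact: ltn_ord.
  rewrite (mtail_ltn (ltn_ord s)) pprodS.
  have -> : (s.+1 * n.+2 = s.+1 * n.+1 + s.+1)%N by lia.
  have -> : (s.+2 * n.+1 = s.+1 * n.+1 + n.+1)%N by lia.
  by rewrite !exprD !(exprS (-1)); ring.
(* The doubled [F 0] turns the factor [1 - 'X^(n.+1)] of [mprod n.+1] into [1 + 'X^(n.+1)]; [F n]
   and the new last summand combine into [pprod n.+1 * 'X^(n.+1 ^ 2)]. *)
rewrite /F mtail0 mtailnn mprodS pprodS mul1n.
have -> : pprod 0 = 1 by rewrite /pprod big_ord0.
have -> : (n.+1 * n.+2 = n.+1 ^ 2 + n.+1)%N by lia.
have -> : (n.+1 * n.+1 = n.+1 ^ 2)%N by lia.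
by rewrite exprD (exprS (-1)); ring.
Qed.

(** Every error term in the finite identity carries an exponent [s.+1 * n.+1], hence at least
    [n.+1]. *)
Lemma eqXn_pprod_theta n : eqXn n.+1 (pprod n * theta n) (mprod n).
Proof.
move=> i iN; rewrite pprod_theta coefD coefMn coef_sum big1 ?mul0rn ?addr0 // => s _.
by rewrite coefMXn; case: ltnP => //; nia.
Qed.

Lemma pprod_coef0 n : (pprod n)`_0 = 1.
Proof.
rewrite -horner_coef0 /pprod horner_prod big1 // => k _.
by rewrite !hornerE expr0n addr0.
Qed.

Lemma mprod_coef0 n : (mprod n)`_0 = 1.
Proof.
rewrite -horner_coef0 /mprod horner_prod big1 // => k _.
by rewrite !hornerE expr0n subr0.
Qed.

(* The weight [(0 < j).+1] counts the choices of overlining a part occurring j times. *)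
Definition overpart_poly (n : nat) : {poly R} :=
  \prod_(i < n) \sum_(j < n.+1) 'X^(i.+1 * j) *+ (0 < j).+1.

(** Factor by factor, [(1 - x)(1 + 2x + ... + 2x^n) = 1 + x - 2x^(n+1)] with [x = 'X^(k.+1)], and
    the last term has degree above [n]. *)
Lemma eqXn_overpart_mprod n : eqXn n.+1 (mprod n * overpart_poly n) (pprod n).
Proof.
rewrite /mprod /overpart_poly -big_split /=; apply: eqXn_prod => k.
suff -> : (1 - 'X^(k.+1)) * (\sum_(j < n.+1) 'X^(k.+1 * j) *+ (0 < j).+1) =
    1 + 'X^(k.+1) + (- 2%:R) * 'X^(k.+1 * n.+1) :> {poly R}.
  by apply: eqXn_addXn; nia.
rewrite big_ord_recl /= muln0 expr0 mulr1n mulrDr.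
have -> : \sum_(j < n) 'X^(k.+1 * bump 0 j) *+ 2 =
    (\sum_(j < n) 'X^(k.+1) ^+ j) * 'X^(k.+1) *+ 2 :> {poly R}.
  rewrite mulr_suml -sumrMnl; apply: eq_bigr => j _.
  by rewrite -exprM -exprD /bump add1n mulnS addnC.
have geo := subrX1 ('X^(k.+1) : {poly R}) n; rewrite -exprM in geo.
rewrite mulnS exprD.
transitivity (1 - 'X^(k.+1) -
    ('X^(k.+1) - 1) * (\sum_(j < n) 'X^(k.+1) ^+ j) * 'X^(k.+1) *+ 2 : {poly R}).
  by ring.
by rewrite -geo; ring.
Qed.

Lemma eqXn_overpart_theta n : eqXn n.+1 (overpart_poly n * theta n) 1.
Proof.
have u0 : (pprod n * mprod n)`_0 = 1 by rewrite coef0M pprod_coef0 mprod_coef0 mulr1.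
apply: (eqXn_mul2l u0); rewrite mulr1.
have -> : pprod n * mprod n * (overpart_poly n * theta n) =
  (mprod n * overpart_poly n) * (pprod n * theta n) by ring.
exact: eqXnM (@eqXn_overpart_mprod n) (@eqXn_pprod_theta n).
Qed.

End Gauss.

(** A truncation of the operator [U_3], which sends [sum a(j) q^j] to [sum a(3j) q^j]. *)
Definition third_coefs (R : nzRingType) n (p : {poly R}) : {poly R} :=
  \poly_(j < n.+1) p`_(3 * j).

(** * Norm, trace and dissection under [q -> wq] *)

Section CubicNorm.
Variables (F : fieldType) (w : F).
Hypothesis w_root : w ^+ 2 + w + 1 = 0.
Implicit Types p q : {poly F}.

Lemma cube_root_cube : w ^+ 3 = 1.
Proof.
by apply/eqP; rewrite -subr_eq0; apply/eqP; rewrite -(mulr0 (w - 1)) -w_root; ring.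
Qed.

(* The norm from F[X] down to F[X^3]. *)
Definition cnorm p := p * (p \Po (w *: 'X)) * (p \Po (w ^+ 2 *: 'X)).

Lemma cnormM p q : cnorm (p * q) = cnorm p * cnorm q.
Proof. by rewrite /cnorm !comp_polyM; ring. Qed.

Lemma eqXn_cnorm N p q : eqXn N p q -> eqXn N (cnorm p) (cnorm q).
Proof. by move=> h; apply: eqXnM; first apply: eqXnM => //; apply: eqXn_comp_polyZX. Qed.

Lemma cube_root_expE k :
  w ^+ k = if (3 %| k)%N then 1 else if (k %% 3 == 1)%N then w else w ^+ 2.
Proof.
rewrite {1}(divn_eq k 3) exprD mulnC exprM cube_root_cube expr1n mul1r /dvdn.
by have := ltn_pmod k (isT : (0 < 3)%N); case: (k %% 3)%N => [|[|[|]]].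
Qed.

(** If 3 divides [k], all three conjugates coincide. Otherwise [w ^+ k] is again a primitive cube
    root of unity, and the product of [1 + cvx] over the cube roots of unity [v] is
    [1 + c^3 x^3]. *)
Lemma cnorm_binom (c : F) k : cnorm (1 + c *: 'X^k) =
  if (3 %| k)%N then (1 + c *: 'X^k) ^+ 3 else 1 + c ^+ 3 *: 'X^(3 * k).
Proof.
have wP : (w%:P) ^+ 2 + w%:P + 1 = 0 :> {poly F} by rewrite -polyC_exp -!polyCD w_root.
have w3P : (w%:P) ^+ 3 = 1 :> {poly F} by rewrite -polyC_exp cube_root_cube.
rewrite /cnorm !comp_polyD !comp_polyC !comp_polyZ !comp_Xn_poly !exprZn.
rewrite -!exprM mulnC exprM cube_root_expE.
case: ifP => _; first by rewrite expr1n !scale1r; ring.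
rewrite -!mul_polyC mulnC exprM; set x := 'X^k.
have key v : v ^+ 2 + v + 1 = 0 -> v ^+ 3 = 1 ->
    (1 + c%:P * x) * (1 + c%:P * (v * x)) * (1 + c%:P * (v ^+ 2 * x)) =
    1 + (c%:P) ^+ 3 * x ^+ 3.
  move=> v2 v3.
  transitivity (1 + (v ^+ 2 + v + 1) * (c%:P * x) + v * (v ^+ 2 + v + 1) * (c%:P * x) ^+ 2
     + v ^+ 3 * (c%:P * x) ^+ 3); first by ring.
  by rewrite v2 v3; ring.
rewrite !polyC_exp; case: ifP => _; rewrite ?polyC_exp; first exact: key.
(* Here [k] is 2 modulo 3 and [v] is [w ^+ 2], a root of the same quadratic because [w^4 = w]. *)
apply: key; last by rewrite -exprM mulnC exprM w3P expr1n.
rewrite -[RHS]wP; transitivity (w%:P ^+ 3 * w%:P + w%:P ^+ 2 + 1); first by ring.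
by rewrite w3P; ring.
Qed.

Definition binprod (c : F) n : {poly F} := \prod_(k < n) (1 + c *: 'X^(k.+1)).

Lemma mprod_binprod n : mprod F n = binprod (-1) n.
Proof. by apply: eq_bigr => k _; rewrite scaleN1r. Qed.

Lemma pprod_binprod n : pprod F n = binprod 1 n.
Proof. by apply: eq_bigr => k _; rewrite scale1r. Qed.

Lemma binprodS c n : binprod c n.+1 = binprod c n * (1 + c *: 'X^(n.+1)).
Proof. by rewrite /binprod big_ord_recr. Qed.

(** Each induction step adds the exponents [3n+1], [3n+2], [3n+3]. The first two have norm
    [1 + c X^(3k)]; the third gives a cube instead, so its factor [1 + c X^(9(n+1))] is supplied by
    the composition with ['X^9]. Both signs [c = 1] and [c = -1] satisfy [c ^+ 3 = c]. *)
Lemma cnorm_binprod c n : c ^+ 3 = c ->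
  cnorm (binprod c (3 * n)) * (binprod c n \Po 'X^9) =
  (binprod c (3 * n) \Po 'X^3) * (binprod c n \Po 'X^3) ^+ 3.
Proof.
move=> c3; elim: n => [|n IH].
  by rewrite muln0 /binprod !big_ord0 /cnorm !comp_polyC; ring.
have e m d : (1 + c *: 'X^m) \Po 'X^d = 1 + c *: 'X^(d * m) :> {poly F}.
  by rewrite comp_polyD comp_polyC comp_polyZ comp_Xn_poly -exprM.
have -> : (3 * n.+1 = (3 * n).+3)%N by lia.
rewrite !binprodS !cnormM !comp_polyM !e !cnorm_binom c3.
have -> : (3 %| (3 * n).+1)%N = false by lia.
have -> : (3 %| (3 * n).+2)%N = false by lia.
have -> : (3 %| (3 * n).+3)%N by lia.
have -> : (3 * (3 * n).+3 = 9 * n.+1)%N by lia.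
have -> : ((3 * n).+3 = 3 * n.+1)%N by lia.
move: IH; set N1 := cnorm _; set B9 := _ \Po 'X^9; set B3 := binprod c (3 * n) \Po _.
set B1 := binprod c n \Po _ => IH.
set u := 1 + c *: 'X^(3 * _); set v := 1 + _; set x := 1 + _; set y := 1 + _.
transitivity ((N1 * B9) * (u * v * x ^+ 3 * y)); first by ring.
by rewrite IH; ring.
Qed.

Lemma eqXn_binprod c n m : (n <= m)%N -> eqXn n.+1 (binprod c m) (binprod c n).
Proof.
move=> nm; rewrite -(subnKC nm); elim: (m - n)%N => [|k IH]; first by rewrite addn0.
apply: eqXn_trans IH; rewrite addnS binprodS mulrDr mulr1 -scalerAr scalerAl.
by apply: eqXn_addXn; lia.
Qed.

Lemma eqXn_cnorm_binprod c n : c ^+ 3 = c ->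
  eqXn (3 * n).+1 (cnorm (binprod c (3 * n)) * (binprod c n \Po 'X^9))
                  ((binprod c n \Po 'X^3) ^+ 4).
Proof.
move=> c3; rewrite cnorm_binprod // [X in eqXn _ _ X]exprS; apply: eqXnM => //.
apply: (@eqXn_leq _ _ (3 * n.+1)); first by lia.
by apply: eqXn_comp_polyXn => //; apply: eqXn_binprod; lia.
Qed.

Lemma coef0_comp_polyXn d p : (0 < d)%N -> (p \Po 'X^d)`_0 = p`_0.
Proof. by move=> d0; rewrite coef_comp_poly_Xn // dvdn0 div0n. Qed.

(** As [theta] is the quotient of [mprod] by [pprod] and the norm is multiplicative, this is the
    quotient of the norm formulas at [c = -1] and [c = 1], obtained by cancelling the fourth power
    of [pprod] at ['X^3]. *)
Lemma eqXn_cnorm_theta n :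
  eqXn (3 * n).+1 (cnorm (theta F (3 * n)) * (theta F n \Po 'X^9))
                  ((theta F n \Po 'X^3) ^+ 4).
Proof.
have N1 : (-1 : F) ^+ 3 = -1 by ring.
have P1 : (1 : F) ^+ 3 = 1 by ring.
have := eqXn_cnorm_binprod (n := n) N1; rewrite -!mprod_binprod => hE.
have := eqXn_cnorm_binprod (n := n) P1; rewrite -!pprod_binprod => hD.
have h := eqXn_cnorm (@eqXn_pprod_theta F (3 * n)); rewrite cnormM in h.
have h3 : eqXn (3 * n).+1 ((pprod F n \Po 'X^3) * (theta F n \Po 'X^3)) (mprod F n \Po 'X^3).
  rewrite -comp_polyM; apply: (@eqXn_leq _ _ (3 * n.+1)); first by lia.
  by apply: eqXn_comp_polyXn => //; apply: eqXn_pprod_theta.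
have h9 : eqXn (3 * n).+1 ((pprod F n \Po 'X^9) * (theta F n \Po 'X^9)) (mprod F n \Po 'X^9).
  rewrite -comp_polyM; apply: (@eqXn_leq _ _ (9 * n.+1)); first by lia.
  by apply: eqXn_comp_polyXn => //; apply: eqXn_pprod_theta.
have u0 : ((pprod F n \Po 'X^3) ^+ 4)`_0 = 1.
  by rewrite -!horner_coef0 horner_exp horner_coef0 coef0_comp_polyXn // pprod_coef0 expr1n.
apply: (eqXn_mul2l u0); rewrite -exprMn.
move: hE hD h h3 h9.
set d3 := pprod F n \Po _; set d9 := pprod F n \Po _; set nd := cnorm (pprod _ _).
set e3 := mprod F n \Po _; set e9 := mprod F n \Po _; set ne := cnorm (mprod _ _).
set t3 := theta F n \Po _; set t9 := theta F n \Po _; set nt := cnorm _.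
move=> hE hD h h3 h9.
apply: eqXn_trans (eqXn_sym (eqXnX 4 h3)).
apply: eqXn_trans hE.
apply: eqXn_trans (eqXnM h h9).
have -> : nd * nt * (d9 * t9) = (nd * d9) * (nt * t9) by ring.
by apply: eqXnM => //; apply: eqXn_sym.
Qed.

(* Squares are 0 modulo 9 or 1 modulo 3. *)
Lemma theta_dissection n : exists B : {poly F},
  theta F (3 * n) = (theta F n \Po 'X^9) + B *+ 2 /\
  forall u : F, u ^+ 3 = 1 -> B \Po (u *: 'X) = u *: B.
Proof.
elim: n => [|n [B [hB tB]]].
  by exists 0; split=> [|u _]; rewrite ?comp_poly0 ?scaler0 //
    muln0 /theta !big_ord0 mul0rn !addr0 comp_polyC.
exists (B + (-1) ^+ (3 * n).+1 * 'X^((3 * n).+1 ^ 2) +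
            (-1) ^+ (3 * n).+2 * 'X^((3 * n).+2 ^ 2)); split=> [|u u3].
  have -> : (3 * n.+1 = (3 * n).+3)%N by lia.
  have S m : theta F m.+1 = theta F m + (-1) ^+ m.+1 * 'X^(m.+1 ^ 2) *+ 2.
    by rewrite /theta big_ord_recr /= mulrnDl addrA.
  rewrite !S hB comp_polyD raddfMn /= comp_polyM comp_Xn_poly.
  rewrite -(polyC1 F) -polyCN -!polyC_exp comp_polyC -exprM.
  have -> : ((3 * n).+3 ^ 2 = 9 * n.+1 ^ 2)%N by lia.
  have -> : (-1 : F) ^+ (3 * n).+3 = (-1) ^+ n.+1.
    have -> : ((3 * n).+3 = 3 * n.+1)%N by lia.
    by rewrite exprM; congr (_ ^+ _); ring.
  by rewrite !mulrnDl; ring.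
have su m : u ^+ (3 * m).+1 = u by rewrite exprS exprM u3 expr1n mulr1.
have h m k : (m ^ 2 = (3 * k).+1)%N ->
    ((-1) ^+ m * 'X^(m ^ 2)) \Po (u *: 'X) = u *: ((-1) ^+ m * 'X^(m ^ 2) : {poly F}).
  move=> mk; rewrite comp_polyM comp_Xn_poly exprZn {1}mk su.
  by rewrite -(polyC1 F) -polyCN -!polyC_exp comp_polyC scalerAr.
(* The witnesses come from [(3n+1)^2 = 3(3n^2+2n) + 1] and [(3n+2)^2 = 3(3n^2+4n+1) + 1]. *)
rewrite !comp_polyD tB // (h _ (3 * n ^ 2 + 2 * n)%N); last by lia.
by rewrite (h _ (3 * n ^ 2 + 4 * n + 1)%N) ?scalerDr //; lia.
Qed.

Hypothesis three_neq0 : 3%:R != 0 :> F.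

(** The coefficient at [i] is multiplied by [1 + w^i + w^(2i)], which is 3 when 3 divides [i] and 0
    otherwise. *)
Lemma trace_third_coefs n p :
  eqXn (3 * n).+1 (p + (p \Po (w *: 'X)) + (p \Po (w ^+ 2 *: 'X)))
    (3%:R *: (third_coefs n p \Po 'X^3)).
Proof.
move=> i iN; rewrite !coefD !coef_comp_polyZX coefZ coef_comp_poly_Xn //.
rewrite -exprM mulnC exprM cube_root_expE.
case: ifP => [/dvdnP[k ik]|_].
  rewrite ik mulnK // coef_poly ifT; last by lia.
  by rewrite mulnC; ring.
have h : (1 + w + w ^+ 2) * p`_i = 0 by rewrite -addrA addrC [w + _]addrC w_root mul0r.
rewrite mulr0 -[RHS]h; case: ifP => _; first by ring.
transitivity ((1 + w ^+ 2 + w ^+ 3 * w) * p`_i); first by ring.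
by rewrite cube_root_cube; ring.
Qed.

(** With [a0], [a1], [a2] the conjugates of [theta], the trace of [1/theta] is their second
    symmetric function over their norm, that is [3A^2] over [T^4/A]. Hence [P T^4 = A^3], an
    identity in [X^3] from which [X^3] is replaced by [X]. *)
Lemma third_coefs_overpart n :
  eqXn n.+1 (third_coefs n (overpart_poly F (3 * n)) * theta F n ^+ 4)
    ((theta F n \Po 'X^3) ^+ 3).
Proof.
apply: (@eqXn_comp_polyXnI _ 3) => //.
rewrite comp_polyM !rmorphXn /= -comp_polyA comp_Xn_poly -exprM.
have [B [hB tB]] := theta_dissection n.
have hN := @eqXn_cnorm_theta n; have hO := @eqXn_overpart_theta F (3 * n).
have hT := @trace_third_coefs n (overpart_poly F (3 * n)).
have h1 := eqXn_comp_polyZX w hO; have h2 := eqXn_comp_polyZX (w ^+ 2) hO.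
rewrite !comp_polyC !comp_polyM in h1 h2.
have w6 : (w ^+ 2) ^+ 3 = 1 by rewrite -exprM mulnC exprM cube_root_cube expr1n.
have inv9 u : u ^+ 3 = 1 -> (theta F n \Po 'X^9) \Po (u *: 'X) = theta F n \Po 'X^9.
  move=> u3; rewrite -comp_polyA comp_Xn_poly exprZn (exprM u 3 3) u3.
  by rewrite expr1n scale1r.
have wP : (w%:P) ^+ 2 + w%:P + 1 = 0 :> {poly F} by rewrite -polyC_exp -!polyCD w_root.
have cD u : ((theta F n \Po 'X^9) + B *+ 2) \Po u =
    ((theta F n \Po 'X^9) \Po u) + (B \Po u) *+ 2.
  by rewrite [LHS]comp_polyD; congr (_ + _); rewrite !mulr2n comp_polyD.
move: hO h1 h2 hT hN; rewrite /cnorm hB !cD !inv9 ?cube_root_cube //.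
rewrite !tB ?cube_root_cube // -!(mul_polyC _ B) -(mul_polyC 3%:R) polyC_exp.
set O0 := overpart_poly _ _; set O1 := O0 \Po (w *: _); set O2 := O0 \Po _.
set A := theta F n \Po 'X^9; set T := theta F n \Po 'X^3; set P := third_coefs _ _ \Po _.
set a0 := A + B *+ 2; set a1 := A + (w%:P * B) *+ 2; set a2 := A + _ *+ 2.
move=> hO h1 h2 hT hN.
(* The terms linear and quadratic in [B] are multiples of [1 + w + w^2]. *)
have sym2 : a1 * a2 + a0 * a2 + a0 * a1 = 3%:R%:P * A ^+ 2.
  transitivity (3%:R%:P * A ^+ 2 + (w%:P ^+ 2 + w%:P + 1) *
    (2%:R * A * (B *+ 2) + w%:P * (B *+ 2) ^+ 2)).
    by rewrite /a0 /a1 /a2 polyC_natr; ring.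
  by rewrite wP mul0r addr0.
have key : eqXn (3 * n).+1 (3%:R%:P * (P * T ^+ 4)) (3%:R%:P * A ^+ 3).
  have -> : 3%:R%:P * (P * T ^+ 4) = 3%:R%:P * P * T ^+ 4 by ring.
  apply: eqXn_trans (eqXnM (eqXn_sym hT) (eqXn_sym hN)) _.
  (* Each [Oi] is paired with its own [ai], whose product with it is 1 up to the truncation. *)
  have -> : (O0 + O1 + O2) * (a0 * a1 * a2 * A) =
    (O0 * a0 * (a1 * a2) + O1 * a1 * (a0 * a2) + O2 * a2 * (a0 * a1)) * A by ring.
  have -> : 3%:R%:P * A ^+ 3 = (1 * (a1 * a2) + 1 * (a0 * a2) + 1 * (a0 * a1)) * A.
    by rewrite !mul1r sym2; ring.
  by do ?[apply: eqXnM => // | apply: eqXnD => //].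
by move=> i iN; have := key i iN; rewrite !coefCM; apply: mulfI.
Qed.

End CubicNorm.

(** * Combinatorial meaning of the coefficients *)

Lemma card_overlinings n (m : {ffun 'I_n -> 'I_n.+1}) :
  #|[set o : {ffun 'I_n -> bool} | [forall i, o i ==> (0 < m i)%N]]| =
  (\prod_(i < n) (0 < m i).+1)%N.
Proof.
transitivity (\prod_(i < n) #|[pred b : bool | b ==> (0 < m i)%N]|)%N.
  have := card_family (fun i => [pred b : bool | b ==> (0 < m i)%N]).
  rewrite foldrE big_image /= => <-; rewrite cardsE; apply: eq_card => o.
  by apply/forallP/familyP => h i; have := h i.
apply: eq_bigr => i _; case: (0 < m i)%N.
  by rewrite (eq_card (B := predT)) ?card_bool //; case.
by rewrite (eq_card (B := pred1 false)) ?card1 //; case.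
Qed.

(** Distributing the product over the sums enumerates the multiplicity functions [m], each weighted
    by its number of admissible overlinings. *)
Lemma coef_overpart_poly (R : comNzRingType) n :
  (overpart_poly R n)`_n = (overpartition_count n)%:R.
Proof.
rewrite /overpart_poly bigA_distr_bigA coef_sum /overpartition_count.
rewrite cardsE -sum1_card /=.
rewrite (eq_bigl (fun mo : {ffun 'I_n -> 'I_n.+1} * {ffun 'I_n -> bool} =>
   ((\sum_(i < n) i.+1 * mo.1 i)%N == n) && [forall i, mo.2 i ==> (0 < mo.1 i)%N])) //.
rewrite -(pair_big_dep (fun m : {ffun 'I_n -> 'I_n.+1} => (\sum_(i < n) i.+1 * m i)%N == n)
  (fun m (o : {ffun 'I_n -> bool}) => [forall i, o i ==> (0 < m i)%N]) (fun _ _ => 1%N)) /=.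
rewrite natr_sum [RHS]big_mkcond /=; apply: eq_bigr => m _.
have -> : \prod_(i < n) ('X^(i.+1 * m i) *+ (0 < m i).+1) =
    'X^(\sum_(i < n) i.+1 * m i) *+ (\prod_(i < n) (0 < m i).+1) :> {poly R}.
  rewrite -mulr_natr natr_prod -prodrXr -big_split /=.
  by apply: eq_bigr => i _; rewrite mulr_natr.
rewrite coefMn coefXn eq_sym; case: eqP => _; last by rewrite mul0rn.
by rewrite sum1_card -card_overlinings cardsE.
Qed.

Lemma sum_abs_centered (V : nmodType) (g : nat -> V) n :
  \sum_(x < 2 * n + 1) g `|x%:Z - n%:Z|%N = g 0%N + (\sum_(s < n) g s.+1) *+ 2.
Proof.
elim: n => [|n IH].
  by rewrite big_ord0 mul0rn addr0 big_ord_recl big_ord0 addr0.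
have -> : (2 * n.+1 + 1 = (2 * n + 1).+2)%N by lia.
rewrite big_ord_recl big_ord_recr /= [in RHS]big_ord_recr /=.
rewrite subn0; have -> : `|(bump 0 (2 * n + 1))%:Z - n.+1%:Z|%N = n.+1 by rewrite /bump; lia.
rewrite (eq_bigr (fun x : 'I_(2 * n + 1) => g `|x%:Z - n%:Z|%N)); last first.
  by move=> x _; congr (g _); rewrite /bump; lia.
by rewrite IH mulrnDl !mulr2n addrCA -!addrA.
Qed.

(** Centring the index makes the expanded power run over the same tuples as [r_sq]. Since [j] and
    [j^2] have equal parity, the sign of a tuple depends only on its sum of squares [n]. *)
Lemma coef_theta_exp (R : comNzRingType) k n :
  (theta R n ^+ k)`_n = (-1) ^+ n * (r_sq k n)%:R.
Proof.
have -> : theta R n = \sum_(x < 2 * n + 1)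
    (-1) ^+ `|x%:Z - n%:Z|%N * 'X^(`|x%:Z - n%:Z|%N ^ 2).
  by rewrite (sum_abs_centered (fun s => (-1) ^+ s * 'X^(s ^ 2))) expr0 mul1r.
rewrite -[k in LHS]card_ord -prodr_const bigA_distr_bigA coef_sum /r_sq -sum1dep_card.
rewrite natr_sum mulr_sumr [RHS]big_mkcond /=; apply: eq_bigr => x _.
have -> : \prod_(i < k) ((-1) ^+ `|(x i)%:Z - n%:Z|%N * 'X^(`|(x i)%:Z - n%:Z|%N ^ 2)) =
    (-1) ^+ (\sum_(i < k) `|(x i)%:Z - n%:Z|%N ^ 2) *
    'X^(\sum_(i < k) `|(x i)%:Z - n%:Z|%N ^ 2) :> {poly R}.
  rewrite -!prodrXr -big_split /=; apply: eq_bigr => i _; congr (_ * _).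
  by rewrite -[in LHS]signr_odd -[in RHS]signr_odd oddX.
have -> : \sum_(i < k) ((x i)%:Z - n%:Z) ^+ 2 =
    (\sum_(i < k) `|(x i)%:Z - n%:Z|%N ^ 2)%N%:Z :> int.
  by rewrite -[RHS]natz natr_sum; apply: eq_bigr => i _; rewrite natz; lia.
rewrite eqz_nat -(polyC1 R) -polyCN -polyC_exp coefCM coefXn eq_sym.
by case: eqP => [->|_]; rewrite ?mulr0.
Qed.

(** * The Frobenius congruence modulo 3 *)

Lemma int_cube_mod3 (z : int) : exists d, z ^+ 3 = z + 3%:R * d.
Proof.
have [q [r [-> hr]]] : exists q r : int, z = q * 3 + r /\ (r = 0 \/ r = 1 \/ r = 2).
  exists (z %/ 3)%Z, (z %% 3)%Z; split; first exact: divz_eq.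
  by have := modz_ge0 z (isT : 3 != 0 :> int); have := ltz_pmod z (isT : 0 < 3 :> int); lia.
case: hr => [->|[->|->]].
- by exists (9 * q ^+ 3 - q); ring.
- by exists (9 * q ^+ 3 + 9 * q ^+ 2 + 3 * q - q); ring.
- by exists (9 * q ^+ 3 + 18 * q ^+ 2 + 12 * q - q + 2); ring.
Qed.

Lemma comp_poly_X3 (p : {poly int}) : exists c, p \Po 'X^3 = p ^+ 3 + 3%:R * c.
Proof.
elim/poly_ind: p => [|p z [c hc]]; first by exists 0; rewrite comp_poly0; ring.
have [d hd] := int_cube_mod3 z.
(* The cross terms of [(pX + z)^3] divided by 3, together with the defect [d] of [z ^+ 3]. *)
exists (c * 'X^3 - p ^+ 2 * 'X^2 * z%:P - p * 'X * z%:P ^+ 2 - d%:P).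
rewrite comp_polyD comp_polyM comp_polyX comp_polyC hc.
have hz : z%:P = z%:P ^+ 3 - 3%:R * d%:P :> {poly int}.
  by rewrite -polyC_exp hd polyCD polyCM polyC_natr addrK.
by rewrite [X in _ + X = _]hz; ring.
Qed.

(** * Descent of the dissection identity to integer coefficients *)

Lemma map_theta (R S : comNzRingType) (f : {rmorphism R -> S}) n :
  map_poly f (theta R n) = theta S n.
Proof.
rewrite /theta rmorphD rmorph1 rmorphMn rmorph_sum /=; congr (_ + _ *+ 2).
by apply: eq_bigr => s _; rewrite rmorphM rmorph_sign /= map_polyXn.
Qed.

Lemma map_overpart_poly (R S : comNzRingType) (f : {rmorphism R -> S}) n :
  map_poly f (overpart_poly R n) = overpart_poly S n.
Proof.
rewrite /overpart_poly rmorph_prod /=; apply: eq_bigr => i _.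
by rewrite rmorph_sum /=; apply: eq_bigr => j _; rewrite rmorphMn /= map_polyXn.
Qed.

Lemma map_third_coefs (R S : comNzRingType) (f : {rmorphism R -> S}) n p :
  map_poly f (third_coefs n p) = third_coefs n (map_poly f p).
Proof.
by apply/polyP => i; rewrite coef_map [in LHS]coef_poly [in RHS]coef_poly coef_map /=;
  case: ifP; rewrite ?rmorph0.
Qed.

Lemma eqXn_mapI (R S : comNzRingType) (f : {rmorphism R -> S}) N (p q : {poly R}) :
  injective f -> eqXn N (map_poly f p) (map_poly f q) -> eqXn N p q.
Proof. by move=> fI h i iN; apply: fI; rewrite -!coef_map h. Qed.

(** The identity is proved over [algC], which contains a primitive cube root of unity, and pulled
    back along the injection of [int]. *)
Lemma third_coefs_overpart_int n :
  eqXn n.+1 (third_coefs n (overpart_poly int (3 * n)) * theta int n ^+ 4)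
    ((theta int n \Po 'X^3) ^+ 3).
Proof.
have [w w_prim] := C_prim_root_exists (isT : (0 < 3)%N).
have w_root : w ^+ 2 + w + 1 = 0.
  apply: (@mulfI _ (w - 1)).
    by rewrite subr_eq0; apply/eqP => w1;
      have := prim_order_dvd w_prim 1; rewrite w1 expr1n eqxx.
  have -> : (w - 1) * (w ^+ 2 + w + 1) = w ^+ 3 - 1 by ring.
  by rewrite (prim_expr_order w_prim) subrr mulr0.
have three0 : 3%:R != 0 :> algC by rewrite pnatr_eq0.
apply: (@eqXn_mapI _ _ (intr : {rmorphism int -> algC})); first exact: intr_inj.
rewrite rmorphM !rmorphXn /= map_comp_poly map_polyXn.
rewrite map_third_coefs map_overpart_poly map_theta.
exact: third_coefs_overpart w_root three0 _.
Qed.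

Theorem theorem5 (n : nat) (hn : (1 <= n)%N) :
  ((overpartition_count (3 * n))%:Z = (-1) ^+ n * (r_sq 5 n)%:Z %[mod 9])%Z.
Proof.
set P := third_coefs n (overpart_poly int (3 * n)).
set O := overpart_poly int n; set t := theta int n.
have [c hc] := comp_poly_X3 t.
have hO : eqXn n.+1 (O ^+ 4 * t ^+ 4) 1.
  by rewrite -exprMn -(expr1n _ 4); apply: eqXnX; apply: eqXn_overpart_theta.
(* [k] is [O ^+ 4] times [((t^3 + 3c)^3 - t^9) / 9]. *)
pose k : {poly int} := O ^+ 4 * (t ^+ 6 * c + 3%:R * t ^+ 3 * c ^+ 2 + 3%:R * c ^+ 3).
have key : eqXn n.+1 P (t ^+ 5 + 9%:R * k).
  (* Multiplying by [O ^+ 4 * t ^+ 4], which is 1 up to the truncation, replaces division by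
     [t ^+ 4]. *)
  apply: (@eqXn_trans _ _ (O ^+ 4 * t ^+ 4 * P)).
    by rewrite -[X in eqXn _ X]mul1r; apply: eqXnM => //; apply: eqXn_sym.
  rewrite -mulrA [t ^+ 4 * P]mulrC.
  apply: eqXn_trans (eqXnM (@eqXn_refl _ _ (O ^+ 4)) (@third_coefs_overpart_int n)) _.
  rewrite hc.
  have -> : O ^+ 4 * (t ^+ 3 + 3%:R * c) ^+ 3 = O ^+ 4 * t ^+ 4 * t ^+ 5 + 9%:R * k.
    by rewrite /k; ring.
  by apply: eqXnD => //; rewrite -[X in eqXn _ _ X]mul1r; apply: eqXnM.
have := key n (ltnSn n).
rewrite coefD coef_theta_exp -[9%:R]polyC_natr coefCM coef_poly ltnSn.
rewrite coef_overpart_poly !natz => ->.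
by rewrite addrC mulrC modzMDl.
Qed.
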